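(* Let $(X_n,x_n)$, $n\ge1$, and $(X,x)$ be pointed good Gromov hyperbolic spaces (or, more generally, pointed Gromov product spaces) such that $(\partial_P X_n,\rho_{x_n})\to(\partial_P X,\rho_x)$ in the sense of almost-isometric convergence. Then the injective hulls satisfy $(E(X_n),x_n)\to(E(X),x)$ in the pointed Gromov-Hausdorff sense.
   Context: **Semi-metric and antipodal spaces.** A compact semi-metric space $(Z,\rho)$ is a compact metrizable space $Z$ with at least four points together with a continuous symmetric function $\rho:Z\times Z\to[0,\infty)$ with $\rho(\xi,\eta)=0$ iff $\xi=\eta$. It is an antipodal space if moreover $\sup_{\xi,\eta}\rho(\xi,\eta)=1$ and for every $\xi\in Z$ there is $\eta\in Z$ with $\rho(\xi,\eta)=1$. **Gromov product spaces.** In a metric space $X$, $(y|z)_x=\frac12(d(y,x)+d(z,x)-d(y,z))$. A Gromov product space is a proper, geodesic, geodesically complete (every geodesic segment extends to a bi-infinite geodesic) metric space $X$ having a second countable Hausdorff compactification $\hat X$ such that for every $x\in X$ the Gromov product $(\cdot|\cdot)_x$ extends to a continuous function $\hat X\times\hat X\to[0,+\infty]$ and, for $\xi,\eta\in\hat X\setminus X$, $(\xi|\eta)_x=+\infty$ iff $\xi=\eta$. The compactification $\hat X$ is unique up to equivalence; $\partial_P X=\hat X\setminus X$ is the Gromov product boundary. For $x\in X$, $\rho_x=\exp(-(\cdot|\cdot)_x)$ on $\partial_P X$; $(\partial_P X,\rho_x)$ is an antipodal space (boundaries are understood to have at least four points). A good Gromov hyperbolic space is a Gromov hyperbolic space that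 is proper, geodesic, geodesically complete and boundary continuous (the Gromov product extends continuously to the Gromov boundary); it is a Gromov product space, with $\partial_P X$ equal to its Gromov boundary $\partial X$. **Injective hull.** $E(X)$ denotes the injective hull (Isbell's hull) of the metric space $X$, with its canonical isometric embedding $X\hookrightarrow E(X)$; a point $x\in X$ is identified with its image in $E(X)$. **Almost-isometric (AI) convergence.** For $\epsilon>0$, an $\epsilon$-isometry $f:(Z_1,\rho_1)\to(Z_2,\rho_2)$ between compact semi-metric spaces is a (not necessarily continuous) map with $\sup_{\xi,\eta\in Z_1}|\rho_2(f(\xi),f(\eta))-\rho_1(\xi,\eta)|<\epsilon$ and such that every point $\eta\in Z_2$ satisfies $\rho_2(f(\zeta),\eta)<\epsilon$ for some $\zeta\in Z_1$. Let $d_{AI}((Z_1,\rho_1),(Z_2,\rho_2))$ be the infimum of $\epsilon>0$ for which there are $\epsilon$-isometries $Z_1\to Z_2$ and $Z_2\to Z_1$. AI-convergence $(Z_n,\rho_n)\to(Z,\rho_0)$ means $d_{AI}((Z_n,\rho_n),(Z,\rho_0))\to0$. **Pointed Gromov-Hausdorff convergence.** A map $f:X\to Y$ of metric spaces (not necessarily continuous) is an $\epsilon$-isometry if $\sup_{x_1,x_2}|d_Y(f(x_1),f(x_2))-d_X(x_1,x_2)|<\epsilon$ and $Y=\bigcup_{x\in X}B_Y(f(x),\epsilon)$. For pointed proper geodesic metric spaces, $(X_n,p_n)\to(X,p)$ means: for every $R>0$ and $\epsilon>0$ there is $n_0$ such that for all $n\ge n_0$ there is an $\epsilon$-isometry $f:B_{X_n}(p_n,R)\to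 B_X(p,R)$ with $f(p_n)=p$. Balls $B_X(p,R)$ are closed. *)

(* Defs.v *)
From HB Require Import structures.
From mathcomp Require Import all_boot all_order all_algebra.
From mathcomp Require Import all_classical all_reals all_analysis.
From mathcomp Require Import lra.

Set Implicit Arguments.
Unset Strict Implicit.
Unset Printing Implicit Defensive.
Import Order.TTheory GRing.Theory Num.Theory.
Import numFieldNormedType.Exports.
Local Open Scope classical_set_scope.
Local Open Scope ring_scope.

(* [closed_ball] in the library is the closure of the open ball, which in a
   general metric space can be smaller. *)
Definition cball {R : realType} {X : metricType R} (p : X) (r : R) : set X :=
  [set y | mdist p y <= r].

Definition proper_space {R : realType} (X : metricType R) : Prop :=
  forall (p : X) (r : R), compact (cball p r).

Definition isometric_on {R : realType} {X : metricType R} (I : set R)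
    (g : R -> X) : Prop :=
  forall s t, I s -> I t -> mdist (g s) (g t) = `|s - t|.

Definition geodesic_space {R : realType} (X : metricType R) : Prop :=
  forall y z : X, exists g : R -> X,
    [/\ isometric_on `[0, mdist y z] g, g 0 = y & g (mdist y z) = z].

Definition geodesically_complete {R : realType} (X : metricType R) : Prop :=
  forall (a b : R) (g : R -> X), a <= b -> isometric_on `[a, b] g ->
    exists2 h : R -> X, isometric_on [set: R] h & {in `[a, b], h =1 g}.

Definition gromov_product {R : realType} {X : metricType R} (x y z : X) : R :=
  2^-1 * (mdist y x + mdist z x - mdist y z).

Record compactification (X : topologicalType) := Compactification {
  cpt_space :> topologicalType ;
  cpt_emb : X -> cpt_space ;
  cpt_compact : compact [set: cpt_space] ;
  cpt_hausdorff : hausdorff_space cpt_space ;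
  cpt_second_countable : @second_countable cpt_space ;
  cpt_emb_inj : injective cpt_emb ;
  (* X carries the topology induced by cpt_space *)
  cpt_emb_open : @open X = [set cpt_emb @^-1` V | V in open] ;
  cpt_emb_dense : dense (range cpt_emb)
}.

Definition remainder {X : topologicalType} (C : compactification X) : set C :=
  ~` range (@cpt_emb X C).

(* The compactification and the extended Gromov products (the latter unique by
   density) are part of the structure. *)
Record gromov_product_space {R : realType} (X : metricType R) :=
    GromovProductSpace {
  gps_proper : proper_space X ;
  gps_geodesic : geodesic_space X ;
  gps_complete : geodesically_complete X ;
  gps_cpt : compactification X ;
  gps_prod : X -> gps_cpt -> gps_cpt -> \bar R ;
  gps_prodE : forall x y z : X,
    gps_prod x (cpt_emb gps_cpt y) (cpt_emb gps_cpt z)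
    = (gromov_product x y z)%:E ;
  gps_prod_ge0 : forall (x : X) (xi eta : gps_cpt),
    (0 <= gps_prod x xi eta)%E ;
  gps_prod_continuous : forall x : X,
    continuous (fun p : gps_cpt * gps_cpt => gps_prod x p.1 p.2) ;
  gps_prod_pinfty : forall (x : X) (xi eta : gps_cpt),
    remainder xi -> remainder eta ->
    gps_prod x xi eta = +oo%E <-> xi = eta ;
  gps_four_points : (`I_4 #<= @remainder X gps_cpt)%card
}.

Definition gp_boundary {R : realType} {X : metricType R}
  (G : gromov_product_space X) : Type := set_type (@remainder X (gps_cpt G)).

(* expeR (- +oo) = 0; the value is finite since gps_prod is nonnegative. *)
Definition rho {R : realType} {X : metricType R} (G : gromov_product_space X)
    (x : X) (xi eta : gp_boundary G) : R :=
  fine (expeR (- gps_prod x (set_val xi) (set_val eta))).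

Definition AI_isometry {R : realType} {Z1 Z2 : Type}
    (rho1 : Z1 -> Z1 -> R) (rho2 : Z2 -> Z2 -> R) (e : R) (f : Z1 -> Z2) :=
  (ereal_sup (range (fun p : Z1 * Z1 =>
     `|rho2 (f p.1) (f p.2) - rho1 p.1 p.2|%:E)) < e%:E)%E /\
  forall eta : Z2, exists zeta : Z1, rho2 (f zeta) eta < e.

Definition d_AI {R : realType} {Z1 Z2 : Type}
    (rho1 : Z1 -> Z1 -> R) (rho2 : Z2 -> Z2 -> R) : \bar R :=
  ereal_inf [set e%:E | e in [set e : R |
    [/\ 0 < e, exists f : Z1 -> Z2, AI_isometry rho1 rho2 e f
      & exists g : Z2 -> Z1, AI_isometry rho2 rho1 e g]]].

Definition AI_converges {R : realType} {Z_ : nat -> Type}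
    (rho_ : forall n, Z_ n -> Z_ n -> R) {Z : Type} (rho0 : Z -> Z -> R) :=
  d_AI (rho_ n) rho0 @[n --> \oo] --> 0%E.

Definition GH_isometry {R : realType} {X Y : metricType R} (e : R)
    (A : set X) (B : set Y) (f : X -> Y) : Prop :=
  [/\ set_fun A B f,
      (ereal_sup [set `|mdist (f p.1) (f p.2) - mdist p.1 p.2|%:E
                   | p in A `*` A] < e%:E)%E
    & forall y, B y -> exists2 u, A u & cball (f u) e y].

Definition pGH_converges {R : realType} {X_ : nat -> metricType R}
    (p_ : forall n, X_ n) {X : metricType R} (p : X) : Prop :=
  forall r e : R, 0 < r -> 0 < e ->
    exists n0 : nat, forall n, (n0 <= n)%N ->
      exists2 f : X_ n -> X, GH_isometry e (cball (p_ n) r) (cball p r) f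
        & f (p_ n) = p.

Definition hull_admissible {R : realType} {X : metricType R} (f : X -> R) :=
  forall y z : X, mdist y z <= f y + f z.

Definition extremal {R : realType} {X : metricType R} (f : X -> R) : Prop :=
  hull_admissible f /\
  forall g : X -> R, hull_admissible g -> (forall y, g y <= f y) -> g = f.

(* A record rather than a set_type, so that the sup metric does not compete with
   the topology set_type inherits from X -> R. *)
Record injective_hull {R : realType} (X : metricType R) := InjectiveHull {
  hull_fun :> X -> R ;
  hull_extremal : extremal hull_fun
}.

HB.instance Definition _ (R : realType) (X : metricType R) :=
  gen_eqMixin (injective_hull X).
HB.instance Definition _ (R : realType) (X : metricType R) :=
  gen_choiceMixin (injective_hull X).

Definition hull_dist {R : realType} {X : metricType R}
    (f g : injective_hull X) : R :=
  sup (range (fun y : X => `|f y - g y|)).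

Section injective_hull_metric.
Context {R : realType} {X : metricType R}.
Implicit Types f g h : injective_hull X.

Lemma hull_ge0 f y : 0 <= f y.
Proof.
have [/(_ y y) + _] := hull_extremal f; rewrite mdistxx; lra.
Qed.

Lemma hull_lip f a b : f a <= mdist a b + f b.
Proof.
have [adm min_f] := hull_extremal f.
pose g y := if y == a then Num.min (f a) (mdist a b + f b) else f y.
suff gE : g = f.
  have : g a = f a by rewrite gE.
  by rewrite /g eqxx => <-; rewrite ge_min lexx orbT.
apply: min_f => [y z|y]; last first.
  by rewrite /g; case: eqP => [->|//]; rewrite ge_min lexx.
have g0 : 0 <= mdist a b by exact: mdist_ge0.
have fb := hull_ge0 f b.
have tri z' : mdist a z' <= mdist a b + mdist b z' by exact: metric_triangle.
have minE : g a = f a \/ g a = mdist a b + f b.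
  by rewrite /g eqxx; case: leP => _; [left|right].
have gE u : u != a -> g u = f u by rewrite /g => /negPf ->.
have [-> {y}|/gE ->] := eqVneq y a;
  have [-> {z}|/gE ->] := eqVneq z a.
- by rewrite mdistxx; have := hull_ge0 f a; case: minE => ->; lra.
- by have := adm a z; have := adm b z; have := tri z; case: minE => ->; lra.
- rewrite (@metric_sym _ X y a); have := adm a y; have := adm b y.
  by have := tri y; case: minE => ->; lra.
- exact: adm.
Qed.

Lemma hull_bounded f g x y : `|f y - g y| <= f x + g x.
Proof.
have := hull_lip f y x; have := hull_lip g y x.
have [/(_ y x) + _] := hull_extremal f; have [/(_ y x) + _] := hull_extremal g.
by rewrite ler_norml => *; apply/andP; split; lra.
Qed.

Lemma le_hull_dist f g y : `|f y - g y| <= hull_dist f g.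
Proof.
apply: ub_le_sup; last by exists y.
by exists (f y + g y) => _ [z _ <-]; exact: hull_bounded.
Qed.

Lemma hull_dist_le f g (c : R) : 0 <= c ->
  (forall y, `|f y - g y| <= c) -> hull_dist f g <= c.
Proof.
move=> c0 fg; rewrite /hull_dist.
have [->|/set0P ne] := eqVneq (range (fun y : X => `|f y - g y|)) set0.
  by rewrite sup0.
by apply: ge_sup => // _ [y _ <-].
Qed.

Lemma hull_dist_ge0 f g : 0 <= hull_dist f g.
Proof.
have [E0|/set0P[_ [y _ _]]] := eqVneq (range (fun y : X => `|f y - g y|)) set0.
  by rewrite /hull_dist E0 sup0.
exact: le_trans (normr_ge0 _) (le_hull_dist f g y).
Qed.

Lemma hull_distxx f : hull_dist f f = 0.
Proof.
apply/eqP; rewrite eq_le hull_dist_ge0 andbT.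
by apply: hull_dist_le => // y; rewrite subrr normr0.
Qed.

Lemma hull_eq f g : (f : X -> R) = g -> f = g.
Proof.
case: f g => [f fP] [g gP] /= fg; subst g.
by rewrite (Prop_irrelevance fP gP).
Qed.

Lemma hull_dist_eq0 f g : hull_dist f g = 0 -> f = g.
Proof.
move=> fg; apply/hull_eq/funext => y; apply/eqP.
by rewrite -subr_eq0 -normr_le0 -fg le_hull_dist.
Qed.

Lemma hull_dist_sym f g : hull_dist f g = hull_dist g f.
Proof. by rewrite /hull_dist; congr sup; apply: eq_imagel => y _; rewrite distrC. Qed.

Lemma hull_dist_triangle g f h :
  hull_dist f h <= hull_dist f g + hull_dist g h.
Proof.
apply: hull_dist_le => [|y]; first by rewrite addr_ge0 ?hull_dist_ge0.
by rewrite (le_trans (ler_distD (g y) _ _))// lerD ?le_hull_dist.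
Qed.

HB.instance Definition _ := isMetric.Build R (injective_hull X)
  hull_distxx hull_dist_eq0 hull_dist_sym hull_dist_triangle.

Lemma mdist_hullE f g : mdist f g = sup (range (fun y : X => `|f y - g y|)).
Proof. by []. Qed.

Lemma extremal_mdist (x : X) : extremal (mdist x).
Proof.
split=> [y z|g adm gx].
  by rewrite (@metric_sym _ X x y) metric_triangle.
apply/funext => y; apply/eqP; rewrite eq_le gx /=.
have := adm x y; have := gx x; rewrite mdistxx; lra.
Qed.

Definition hull_emb (x : X) : injective_hull X :=
  InjectiveHull (extremal_mdist x).

Lemma mdist_hull_emb (x y : X) : mdist (hull_emb x) (hull_emb y) = mdist x y.
Proof.
apply/eqP; rewrite eq_le; apply/andP; split.
  apply: hull_dist_le => [|z]; first exact: mdist_ge0.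
  rewrite /= ler_norml; have := @metric_triangle _ X x y z.
  have := @metric_triangle _ X y x z; rewrite (@metric_sym _ X y x).
  by move=> *; apply/andP; split; lra.
have := le_hull_dist (hull_emb x) (hull_emb y) y.
by rewrite /= mdistxx subr0 ger0_norm ?mdist_ge0.
Qed.

End injective_hull_metric.

(* Main.v *)
Require Import Defs.
From mathcomp Require Import all_boot all_order all_algebra.
From mathcomp Require Import all_classical all_reals all_analysis.
From mathcomp Require Import ring lra.

Set Implicit Arguments.
Unset Strict Implicit.
Unset Printing Implicit Defensive.
Import Order.TTheory GRing.Theory Num.Theory.
Import numFieldNormedType.Exports.
Local Open Scope classical_set_scope.
Local Open Scope ring_scope.

(** A point of E(X) is an extremal function f on X, and f z = d(x,z) when f is
    the base point.  It is convenient to subtract that function: F z = f z -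
    d(x,z) satisfies F u + F v >= -2 (u|v)_x, with near-equality for a suitable
    v, and |F| <= f x, where f x is exactly the distance of f to the base point.
    On the ball of radius r one thus has |F| <= r, so only the truncated
    products min((u|v)_x, r) matter: the ball is governed by a bounded kernel.

    Geodesic completeness makes the points far away from x enough.  A segment
    from u to z with f u + f z close to d(u,z) extends beyond z without spoiling
    that near-equality (far_detecting), so extremal functions and their distances
    are determined on the complement of any ball (hull_dist_le_detecting).
    Consequently a correspondence between far points of X and far points of Y
    that almost preserves the truncated products almost identifies the r-balls of
    the two hulls (hull_transfer, hull_GH_isometry).

    Such a correspondence comes from an almost-isometry of the boundaries.  The
    function exp(-(.|.)_x) extends continuously to the compactification, which is
    compact, so a far point of X and a nearby boundary point have uniformly close
    values of this function against every third point (far_approx,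
    remainder_approx).  Far points are therefore matched through the boundaries
    (far_correspondence).  A small value of rho between two boundary points of
    the limit space forces them to be uniformly close (small_visual_close);
    this is what turns almost-surjectivity, which only speaks of small values of
    rho, into a statement about the whole kernel.  It is applied in the fixed limit
    space, and so with a threshold that serves all n. *)

(** * Extremal functions *)

Section hull.
Context {R : realType}.

Lemma admissible_ge0 (X : metricType R) (f : X -> R) (y : X) :
  hull_admissible f -> 0 <= f y.
Proof. by move=> /(_ y y); rewrite mdistxx; lra. Qed.

Lemma ball_hull_ge (X : metricType R) (f : injective_hull X) (x y : X) (r : R) :
  f x <= r -> - r <= f y - mdist x y.
Proof.
have := (hull_extremal f).1 y x; rewrite (@metric_sym _ X y x); lra.
Qed.

Lemma ball_hull_le (X : metricType R) (f : injective_hull X) (x y : X) (r : R) :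
  f x <= r -> f y - mdist x y <= r.
Proof.
have := hull_lip f y x; rewrite (@metric_sym _ X y x); lra.
Qed.

Lemma mdist_hull_embl (X : metricType R) (x : X) (f : injective_hull X) :
  mdist (hull_emb x) f = f x.
Proof.
have fx0 := hull_ge0 f x.
apply/eqP; rewrite eq_le; apply/andP; split.
  apply: hull_dist_le => // y /=; rewrite distrC ler_norml.
  by rewrite (ball_hull_ge y (lexx _)) (ball_hull_le y (lexx _)).
by have := le_hull_dist (hull_emb x) f x; rewrite /= mdistxx sub0r normrN ger0_norm.
Qed.

(** Zorn's lemma: the infimum of a chain of admissible functions is admissible,
    because two members of a chain lie above the smaller one of them. *)
Lemma extremal_minorant (X : metricType R) (H : X -> R) : hull_admissible H ->
  exists g : injective_hull X, forall y, g y <= H y.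
Proof.
move=> admH.
pose P h := hull_admissible h /\ forall y : X, h y <= H y.
pose T := {h : X -> R | P h}.
pose below (a b : T) := `[< forall y, sval b y <= sval a y >].
have [a|a b c|a b|A totA|[m [adm_m mH]] max_m] := @Zorn T below.
- exact/asboolP.
- by move=> /asboolP ab /asboolP bc; apply/asboolP => y; exact: le_trans (bc y) (ab y).
- case: a b => [a aP] [b bP] /asboolP /= ab /asboolP /= ba.
  have eab : a = b by apply/funext => y; apply/le_anti; rewrite ab ba.
  by subst b; rewrite (Prop_irrelevance aP bP).
- have [->|/set0P[a0 Aa0]] := eqVneq A set0.
    by exists (exist P H (conj admH (fun y => lexx _))) => s.
  pose E y := [set sval a y | a in A].
  have E0 y : E y !=set0 by exists (sval a0 y); exists a0.
  have lbE y : has_inf (E y).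
    split=> //; exists 0 => _ [a _ <-]; exact: admissible_ge0 (svalP a).1.
  have infE a y : A a -> inf (E y) <= sval a y.
    by move=> Aa; apply: ge_inf; [exact: (lbE y).2 | exists a].
  suff adm : hull_admissible (fun y => inf (E y)).
    have leH y : inf (E y) <= H y.
      exact: le_trans (infE a0 y Aa0) ((svalP a0).2 y).
    by exists (exist P _ (conj adm leH)) => s As; apply/asboolP => y; exact: infE.
  move=> y z; rewrite -lerBlDr; apply: lb_le_inf => // _ [a Aa <-].
  rewrite lerBlDr addrC -lerBlDr; apply: lb_le_inf => // _ [b Ab <-].
  have [/asboolP ab|/asboolP ba] := totA _ _ Aa Ab.
    by have := (svalP b).1 y z; have := ab y; rewrite /=; lra.
  by have := (svalP a).1 y z; have := ba z; rewrite /=; lra.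
have ext_m : extremal m.
  split=> // g adm_g gm.
  have gH y : g y <= H y by exact: le_trans (gm y) (mH y).
  by have /(congr1 sval) := max_m (exist P g (conj adm_g gH)) (asboolT gm).
by exists (InjectiveHull ext_m).
Qed.

(** Otherwise f could be lowered by e / 2 at the single point u and remain
    admissible. *)
Lemma extremal_tight (X : metricType R) (f : injective_hull X) (u : X) (e : R) :
  0 < e -> exists z, f u + f z <= mdist u z + e.
Proof.
move=> e0; apply/not_existsP => H.
have {}H z : mdist u z + e < f u + f z by rewrite ltNge; apply/negP/H.
have [adm min_f] := hull_extremal f.
pose g y := if y == u then f u - e / 2 else f y.
suff gE : g = f by have := congr1 (@^~ u) gE; rewrite /g eqxx; lra.
have fu : e < f u + f u by have := H u; rewrite mdistxx; lra.
apply: min_f => [y z|y]; last by rewrite /g; case: eqP => [->|_] //; lra.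
rewrite /g; case: eqP => [->|_]; case: eqP => [->|_].
- by rewrite mdistxx; lra.
- by have := H z; lra.
- by have := H y; rewrite (@metric_sym _ X y u); lra.
- exact: adm.
Qed.

(** The points of S suffice to recover every extremal function:
    f u = sup over s in S of d(u,s) - f s. *)
Definition detecting {X : metricType R} (S : set X) :=
  forall (f : injective_hull X) (u : X) (e : R), 0 < e ->
  exists2 s, S s & f u + f s <= mdist u s + e.

(** Let f u + f z be close to d(u,z).  On a geodesic extending the segment from u
    to z, a point w beyond z has d(u,w) = d(u,z) + d(z,w), while f w is at most
    f z + d(z,w); hence w serves u as well as z does, and w can be taken as far
    away as desired. *)
Lemma far_detecting (X : metricType R) (x : X) (t : R) :
  geodesic_space X -> geodesically_complete X ->
  detecting [set y | t <= mdist x y].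
Proof.
move=> geoX compX f u e e0.
have [z fz] := extremal_tight f u e0.
have [g [isog g0 gz]] := geoX u z.
have duz0 := @mdist_ge0 _ X u z.
have [h isoh hg] := compX _ _ g duz0 isog.
pose T := mdist u z + mdist x u + `|t|.
have dxu0 := @mdist_ge0 _ X x u.
have t0 := normr_ge0 t; have tt := ler_norm t.
have h0 : h 0 = u by rewrite hg ?g0// in_itv /= lexx.
have hz : h (mdist u z) = z by rewrite hg ?gz// in_itv /= lexx duz0.
have duT : mdist u (h T) = T.
  by rewrite -h0 isoh// sub0r normrN ger0_norm// /T; lra.
have dzT : mdist z (h T) = T - mdist u z.
  by rewrite -{1}hz isoh// distrC ger0_norm// /T; lra.
exists (h T) => /=.
  have := @metric_triangle _ X u x (h T); rewrite duT /T (@metric_sym _ X u x); lra.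
have := hull_lip f (h T) z; rewrite duT (@metric_sym _ X _ z) dzT; lra.
Qed.

Lemma hull_dist_le_detecting (X : metricType R) (S : set X)
    (f g : injective_hull X) (c : R) :
  detecting S -> 0 <= c -> (forall s, S s -> `|f s - g s| <= c) ->
  hull_dist f g <= c.
Proof.
move=> detS c0 fg; apply: hull_dist_le => // y.
suff half (a b : injective_hull X) : (forall s, S s -> `|a s - b s| <= c) ->
    a y - b y <= c.
  rewrite ler_norml lerNl opprB !half// => s Ss; rewrite distrC; exact: fg.
move=> ab; apply/ler_addgt0Pr => e e0.
have [s Ss hs] := detS a y e e0.
have := (hull_extremal b).1 y s; have := ab s Ss; rewrite ler_norml; lra.
Qed.

(** * Transfer of extremal functions along correspondences *)

Definition correspondence {X Y : Type} (S : set X) (T : set Y)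
    (C : X -> Y -> Prop) :=
  (forall s, S s -> exists2 t, T t & C s t) /\
  (forall t, T t -> exists2 s, S s & C s t).

(** Gromov products are cut off at r because boundary data cannot control large
    products: exp(-(.|.)) is then close to 0 in both spaces. *)
Definition distortion_le {X Y : metricType R} (x : X) (y : Y) (r d : R)
    (S : set X) (T : set Y) (C : X -> Y -> Prop) :=
  forall s t s' t', S s -> T t -> C s t -> S s' -> T t' -> C s' t' ->
  `|Num.min (gromov_product x s s') r - Num.min (gromov_product y t t') r| <= d.

Lemma distortion_le_sym (X Y : metricType R) (x : X) (y : Y) (r d : R)
    (S : set X) (T : set Y) (C : X -> Y -> Prop) :
  distortion_le x y r d S T C -> distortion_le y x r d T S (fun t s => C s t).
Proof.
by move=> H s t s' t' *; rewrite distrC; exact: H.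
Qed.

Lemma gromov_product_ge0 (X : metricType R) (x y z : X) :
  0 <= gromov_product x y z.
Proof.
have := @metric_triangle _ X y x z; rewrite (@metric_sym _ X x z).
by rewrite /gromov_product; lra.
Qed.

(** In the r-ball the truncation is harmless, since both summands are at least
    - r. *)
Lemma min_product_admissible (X : metricType R) (f : injective_hull X)
    (x u v : X) (r : R) : f x <= r ->
  - 2 * Num.min (gromov_product x u v) r
    <= (f u - mdist x u) + (f v - mdist x v).
Proof.
move=> fx; have fu := ball_hull_ge u fx; have fv := ball_hull_ge v fx.
have fuv := (hull_extremal f).1 u v.
rewrite /gromov_product (@metric_sym _ X u x) (@metric_sym _ X v x).
by case: (leP (2^-1 * _) r) => _; lra.
Qed.

Lemma min_product_tight (X : metricType R) (f : injective_hull X)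
    (S : set X) (x u : X) (r e : R) : detecting S -> 0 < e ->
  exists2 v, S v & (f u - mdist x u) + (f v - mdist x v)
    <= - 2 * Num.min (gromov_product x u v) r + e.
Proof.
move=> detS e0; have [v Sv fv] := detS f u e e0; exists v => //.
have : Num.min (gromov_product x u v) r <= gromov_product x u v.
  by rewrite ge_min lexx.
rewrite {2}/gromov_product (@metric_sym _ X u x) (@metric_sym _ X v x); lra.
Qed.

(** Copy F = f - d(x,.) to T along the correspondence, raise it by d to make it
    admissible, cut it off at r, and put the value r outside T.  The cut-off keeps
    admissibility because Gromov products are nonnegative and all values are at
    least - r; it forces the extremal function g below to stay in the r-ball.
    Then g is at most the copied function on T by construction, and it is almost
    as large because F s + F s' is almost -2 min((s|s')_x, r) for some s'. *)
Lemma hull_transfer (X Y : metricType R) (x : X) (y : Y) (r d : R)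
    (S : set X) (T : set Y) (C : X -> Y -> Prop) :
  0 < d -> detecting S -> correspondence S T C -> distortion_le x y r d S T C ->
  forall f : injective_hull X, f x <= r ->
  exists2 g : injective_hull Y, g y <= r &
    forall s t, S s -> T t -> C s t ->
      `|(g t - mdist y t) - (f s - mdist x s)| <= 9 * d.
Proof.
move=> d0 detS [C1 C2] dis f fx.
have r0 : 0 <= r := le_trans (hull_ge0 f x) fx.
pose F s := f s - mdist x s.
pose kY u v := Num.min (gromov_product y u v) r.
(* Two points matched with the same t have almost the same kernel, hence almost
   the same value of F (each comparison of kernels costs 2 d, near-equality d):
   the choice of pick below is immaterial. *)
have oscF s1 s2 t : S s1 -> S s2 -> T t -> C s1 t -> C s2 t ->
    F s1 <= F s2 + 5 * d.
  move=> S1 S2 Tt C1t C2t.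
  have [s' Ss' hs'] := min_product_tight f x s1 r detS d0.
  have [t' Tt' C't'] := C1 _ Ss'.
  have := min_product_admissible s2 s' fx.
  have := dis _ _ _ _ S1 Tt C1t Ss' Tt' C't'.
  have := dis _ _ _ _ S2 Tt C2t Ss' Tt' C't'.
  by rewrite !ler_norml /F; lra.
have [pick pickP] : exists p : Y -> X, forall t, T t -> S (p t) /\ C (p t) t.
  have [p pP] : {p : Y -> X & forall t, T t -> S (p t) /\ C (p t) t}.
    apply: (@choice _ _ (fun t s => T t -> S s /\ C s t)) => t.
    by have [/C2[s Ss Cst]|nT] := pselect (T t); [exists s | exists x].
  by exists p.
pose H t := mdist y t + (if `[< T t >] then Num.min (F (pick t) + d) r else r).
have HF t : H t - mdist y t <= r.
  by rewrite /H; case: asboolP => _; [case: (leP (F _ + d) r)|]; lra.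
have admH : hull_admissible H.
  move=> t t'.
  have lo u : T u -> - r <= F (pick u) by move=> _; exact: ball_hull_ge.
  have gp0 := gromov_product_ge0 y t t'.
  have kYle : kY t t' <= gromov_product y t t' by rewrite /kY ge_min lexx.
  have dgp : mdist t t' = mdist y t + mdist y t' - 2 * gromov_product y t t'.
    by rewrite /gromov_product (@metric_sym _ Y t y) (@metric_sym _ Y t' y); lra.
  have cross : T t -> T t' ->
      - 2 * gromov_product y t t' <= F (pick t) + d + (F (pick t') + d).
    move=> Tt Tt'; have [St Ct] := pickP _ Tt; have [St' Ct'] := pickP _ Tt'.
    have := dis _ _ _ _ St Tt Ct St' Tt' Ct'.
    have := min_product_admissible (pick t) (pick t') fx.
    by rewrite -/(kY t t') ler_norml /F; lra.
  rewrite /H dgp.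
  case: asboolP => [Tt|_]; case: asboolP => [Tt'|_].
  - have ctt' := cross Tt Tt'; have lt := lo _ Tt; have lt' := lo _ Tt'.
    by case: (leP (F _ + d) r) => _; case: (leP (F (pick t') + d) r) => _; lra.
  - by have lt := lo _ Tt; case: (leP (F _ + d) r) => _; lra.
  - by have lt' := lo _ Tt'; case: (leP (F _ + d) r) => _; lra.
  - lra.
have [g gH] := extremal_minorant admH.
have gy : g y <= r by have := gH y; have := HF y; rewrite mdistxx; lra.
exists g => // s t Ss Tt Cst.
have up t' : T t' -> g t' - mdist y t' <= F (pick t') + d.
  move=> Tt'; have := gH t'; rewrite /H asboolT//.
  have : Num.min (F (pick t') + d) r <= F (pick t') + d by rewrite ge_min lexx.
  lra.
have [St Ct] := pickP _ Tt.
have upt := up _ Tt; have osct := oscF _ _ _ St Ss Tt Ct Cst.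
have [s' Ss' hs'] := min_product_tight f x s r detS d0.
have [t' Tt' C't'] := C1 _ Ss'.
have [St' Ct'] := pickP _ Tt'.
have upt' := up _ Tt'; have osct' := oscF _ _ _ St' Ss' Tt' Ct' C't'.
have := min_product_admissible t t' gy.
have := dis _ _ _ _ Ss Tt Cst Ss' Tt' C't'.
by move: upt osct upt' osct' hs'; rewrite !ler_norml /F; lra.
Qed.

(** The map sends f to a function given by hull_transfer, with the base point
    treated separately.  Hull distances are computed on detecting sets, where the
    shifted functions f - d(x,.) change by at most 9 d under the map, hence the
    distance of two of them by at most 18 d; almost-surjectivity is hull_transfer
    for the reversed correspondence. *)
Lemma hull_GH_isometry (X Y : metricType R) (x : X) (y : Y) (r d e : R)
    (S : set X) (T : set Y) (C : X -> Y -> Prop) :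
  0 <= r -> 0 < d -> 18 * d < e -> detecting S -> detecting T ->
  correspondence S T C -> distortion_le x y r d S T C ->
  exists2 Phi : injective_hull X -> injective_hull Y,
    GH_isometry e (cball (hull_emb x) r) (cball (hull_emb y) r) Phi &
    Phi (hull_emb x) = hull_emb y.
Proof.
move=> r0 d0 de detS detT cor dis.
pose near (f : injective_hull X) (g : injective_hull Y) :=
  forall s t, S s -> T t -> C s t ->
  `|(g t - mdist y t) - (f s - mdist x s)| <= 9 * d.
have [Phi PhiP] : {Phi : injective_hull X -> injective_hull Y &
    forall f : injective_hull X, f x <= r -> [/\ Phi f y <= r, near f (Phi f) &
                           f = hull_emb x -> Phi f = hull_emb y]}.
  apply: (@choice _ _ (fun (f : injective_hull X) (g : injective_hull Y) => f x <= r ->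
    [/\ g y <= r, near f g & f = hull_emb x -> g = hull_emb y])) => f.
  have [->|fx] := pselect (f = hull_emb x).
    exists (hull_emb y) => _; split=> //=; first by rewrite mdistxx.
    by move=> s t _ _ _ /=; rewrite !subrr normr0; lra.
  have [fr|nfr] := pselect (f x <= r); last by exists (hull_emb y).
  have [g gr fg] := hull_transfer d0 detS cor dis fr.
  by exists g.
have cor' : correspondence T S (fun t s => C s t).
  by case: cor => c1 c2; split.
exists Phi; last by have [|_ _ ->//] := PhiP (hull_emb x); rewrite /= mdistxx.
split=> [f|| g].
- rewrite /cball /= !mdist_hull_embl => fr.
  by have [] := PhiP f fr.
- apply: (@le_lt_trans _ _ (18 * d)%:E); last by rewrite lte_fin.
  apply: ge_ereal_sup => _ [[f1 f2] [/= +  +] <-].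
  rewrite /cball /= !mdist_hull_embl => fr1 fr2; rewrite lee_fin.
  have [gr1 n1 _] := PhiP f1 fr1; have [gr2 n2 _] := PhiP f2 fr2.
  have d12 := hull_dist_ge0 f1 f2.
  have g12 := hull_dist_ge0 (Phi f1) (Phi f2).
  have h1 : hull_dist (Phi f1) (Phi f2) <= hull_dist f1 f2 + 18 * d.
    apply: (hull_dist_le_detecting detT) => [|t Tt]; first lra.
    have [s Ss Cst] := cor.2 t Tt.
    have := n1 _ _ Ss Tt Cst; have := n2 _ _ Ss Tt Cst.
    have := le_hull_dist f1 f2 s; rewrite !ler_norml; lra.
  have h2 : hull_dist f1 f2 <= hull_dist (Phi f1) (Phi f2) + 18 * d.
    apply: (hull_dist_le_detecting detS) => [|s Ss]; first lra.
    have [t Tt Cst] := cor.1 s Ss.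
    have := n1 _ _ Ss Tt Cst; have := n2 _ _ Ss Tt Cst.
    have := le_hull_dist (Phi f1) (Phi f2) t; rewrite !ler_norml; lra.
  by rewrite ler_norml -[mdist (Phi _) _]/(hull_dist _ _) -[mdist f1 _]/(hull_dist _ _); lra.
- rewrite {1}/cball /= mdist_hull_embl => gr.
  have [f fr gf] := hull_transfer d0 detT cor' (distortion_le_sym dis) gr.
  exists f; first by rewrite /cball /= mdist_hull_embl.
  have [_ n _] := PhiP f fr.
  rewrite /cball /= -[mdist (Phi _) _]/(hull_dist _ _).
  apply: (@le_trans _ _ (18 * d)); last lra.
  apply: (hull_dist_le_detecting detT) => [|t Tt]; first lra.
  have [s Ss Cst] := cor.2 t Tt.
  have := n _ _ Ss Tt Cst; have := gf _ _ Tt Ss Cst; rewrite !ler_norml; lra.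
Qed.

End hull.

(** * The boundary semi-metric extended to the compactification *)

Section visual.
Context {R : realType}.

(** Around every b the bound holds for a' in some neighbourhood of a; compactness
    gives one neighbourhood of a for all b. *)
Lemma uniform_slice (K : topologicalType) (F : K * K -> R) (a : K) (e : R) :
  compact [set: K] -> continuous F -> 0 < e ->
  \forall a' \near a, forall b, `|F (a', b) - F (a, b)| <= e.
Proof.
move=> /compact_near_coveringP cptK contF e0.
pose close a' b := `|F (a', b) - F (a, b)| <= e.
have loc b : [set: K] b -> \forall b' \near b & a' \near a, close a' b'.
  move=> _; have e2 : 0 < e / 2 by rewrite divr_gt0.
  have /cvgrPdist_lt/(_ _ e2) [[A B] /= [nA nB] AB] := contF (a, b).
  exists (B, A) => // -[b' a'] /= [Bb' Aa'].
  have := AB (a', b') (conj Aa' Bb'); have := AB (a, b') (conj (nbhs_singleton nA) Bb').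
  by rewrite /close /= !ltr_norml ler_norml; lra.
by apply: filterS (cptK _ (nbhs a) close _ loc) => a' ca' b; exact: ca'.
Qed.

Lemma fine_expeRN_lt (u : \bar R) (e : R) : 0 < e -> ((- ln e)%:E < u)%E ->
  fine (expeR (- u)) < e.
Proof.
move=> e0; case: u => [u| |] //=.
by rewrite lte_fin ltrNl => /(conj e0) [? ?]; rewrite -[ltRHS]lnK ?posrE// ltr_expR.
Qed.

Lemma continuous_fine_expeRN (K : topologicalType) (P : K -> \bar R) :
  (forall p, 0 <= P p)%E -> continuous P ->
  continuous (fun p => fine (expeR (- P p)) : R).
Proof.
move=> P0 contP p; have := contP p; have := P0 p.
rewrite /continuous_at.
case: (P p) => [r _ cP|_ cP|//].
- have /fine_cvgP[finP fP] := cP.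
  have eP : expR (- fine (P q)) @[q --> p] --> expR (- r).
    have nP : - fine (P q) @[q --> p] --> - r by exact: cvgN fP.
    exact: (cvg_comp _ _ nP (@continuous_expR R (- r))).
  apply: cvg_trans eP; apply: near_eq_cvg; near=> q.
  have : P q \is a fin_num by near: q.
  by case: (P q).
- rewrite /=; apply/cvgrPdist_lt => e e0.
  have : \forall q \near p, ((- ln e)%:E < P q)%E.
    exact: (cP _ (nbhs_open_ereal_pinfty _)).
  apply: filterS => q /(fine_expeRN_lt e0) ve.
  rewrite sub0r normrN ger0_norm// fine_ge0// expeR_ge0//.
Unshelve. all: by end_near.
Qed.

Section boundary.
Context {X : metricType R} (G : gromov_product_space X) (x : X).
Let C := gps_cpt G.
Let emb : X -> C := cpt_emb C.

(** Coincides with rho x on the remainder; defined on all of C, it also compares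
    interior points with boundary points. *)
Definition visual (a b : C) : R := fine (expeR (- gps_prod x a b)).

Lemma visual_emb y z : visual (emb y) (emb z) = expR (- gromov_product x y z).
Proof. by rewrite /visual /emb gps_prodE. Qed.

Lemma visual_gt0 a b : gps_prod x a b != +oo%E -> 0 < visual a b.
Proof.
rewrite /visual; have := gps_prod_ge0 x a b.
by case: gps_prod => [v _ _|//|//] /=; exact: expR_gt0.
Qed.

(** The diagonal of the extended product extends d(x,.) to C; it is infinite
    exactly on the remainder, and so it measures how far out a point of C is. *)
Lemma gps_prod_diag y : gps_prod x (emb y) (emb y) = (mdist x y)%:E.
Proof.
rewrite /emb gps_prodE /gromov_product mdistxx (@metric_sym _ X y x); congr EFin.
lra.
Qed.

Lemma gps_prod_diag_remainder (xi : C) : remainder xi -> gps_prod x xi xi = +oo%E.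
Proof. by move=> rxi; apply/(gps_prod_pinfty x rxi rxi). Qed.

Lemma remainder_or_emb (a : C) : remainder a \/ exists y, a = emb y.
Proof.
have [[y _ <-]|ra] := pselect (range emb a); first by right; exists y.
by left.
Qed.

Lemma continuous_diag : continuous (fun a : C => gps_prod x a a).
Proof.
move=> a; have := @gps_prod_continuous _ _ G x (a, a).
apply: (@cvg_comp _ _ _ (fun a : C => (a, a)) (fun p => gps_prod x p.1 p.2)).
exact: cvg_pair.
Qed.

Lemma near_diag_gt (xi : C) (t : R) : remainder xi ->
  \forall a \near xi, (t%:E < gps_prod x a a)%E.
Proof.
move=> /gps_prod_diag_remainder xioo.
have := @continuous_diag xi; rewrite /continuous_at xioo => c.
exact: (c _ (nbhs_open_ereal_pinfty t)).
Qed.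

Lemma near_diag_lt (y : X) :
  \forall a \near emb y, (gps_prod x a a < (mdist x y + 1)%:E)%E.
Proof.
have := @continuous_diag (emb y); rewrite /continuous_at gps_prod_diag => c.
have lt1 : ((mdist x y)%:E < (mdist x y + 1)%:E)%E by rewrite lte_fin ltrDl.
exact: (c _ (open_ereal_lt' lt1)).
Qed.

(** Each argument is tested separately, so that two values of visual can be
    compared by moving one argument at a time (visual_close_both). *)
Definition visual_close (d : R) (a a' : C) := forall b,
  `|visual a' b - visual a b| <= d /\ `|visual b a' - visual b a| <= d.

Lemma continuous_visual : continuous (fun p : C * C => visual p.1 p.2).
Proof.
apply: continuous_fine_expeRN => [p|]; first exact: gps_prod_ge0.
exact: gps_prod_continuous.
Qed.

Lemma near_visual_close (a : C) (d : R) : 0 < d ->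
  \forall a' \near a, visual_close d a a'.
Proof.
move=> d0.
have cswap : continuous (fun p : C * C => visual p.2 p.1).
  move=> [u v]; apply: (@cvg_comp _ _ _ (fun p : C * C => (p.2, p.1))
    (fun p : C * C => visual p.1 p.2) _ (nbhs (v, u))).
    by apply: cvg_pair; [exact: cvg_snd | exact: cvg_fst].
  exact: (@continuous_visual (v, u)).
have cptC := @cpt_compact _ C.
near=> a' => b; split; move: b.
  by near: a'; exact: (uniform_slice a cptC continuous_visual d0).
by near: a'; exact: (uniform_slice a cptC cswap d0).
Unshelve. all: by end_near.
Qed.

Lemma visual_close_trans (d1 d2 : R) (a1 a2 a3 : C) :
  visual_close d1 a1 a2 -> visual_close d2 a2 a3 -> visual_close (d1 + d2) a1 a3.
Proof.
by move=> c12 c23 b; have := c12 b; have := c23 b; rewrite !ler_norml; lra.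
Qed.

Lemma visual_close_sym (d : R) (a b : C) :
  visual_close d a b -> visual_close d b a.
Proof.
move=> ab c; have := ab c.
by rewrite ![`|visual _ a - _|]distrC ![`|visual a _ - _|]distrC.
Qed.

Lemma visual_close_both (d d' : R) (a b a' b' : C) :
  visual_close d a b -> visual_close d' a' b' ->
  `|visual b b' - visual a a'| <= d + d'.
Proof.
by move=> /(_ b') [+ _] /(_ a) [_ +]; rewrite !ler_norml; lra.
Qed.

(** X is dense in C, and d(x,.) tends to infinity at xi. *)
Lemma remainder_approx (xi : C) (d t : R) : remainder xi -> 0 < d ->
  exists2 y, t <= mdist x y & visual_close d xi (emb y).
Proof.
move=> rxi d0.
have nU : \forall a \near xi, visual_close d xi a /\ (t%:E < gps_prod x a a)%E.
  by apply: filterI; [exact: near_visual_close | exact: near_diag_gt].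
have [a [/interior_subset /= [ca ta] [y _ ya]]] :=
  @cpt_emb_dense _ C _ (ex_intro _ xi nU) (@open_interior _ _).
exists y; last by rewrite /emb ya.
by move: ta; rewrite -ya -/emb gps_prod_diag lte_fin => /ltW.
Qed.

(** Every point of C has a neighbourhood where the claim holds for large t: near a
    boundary point xi because that xi works, near emb y because d(x,.) is bounded
    there.  Compactness of C gives one t for all. *)
Lemma far_approx (d : R) : 0 < d -> exists t, forall y, t <= mdist x y ->
  exists2 xi, remainder xi & visual_close d xi (emb y).
Proof.
move=> d0; have /compact_near_coveringP cptC := @cpt_compact _ C.
pose P (t : R) (a : C) := (t%:E <= gps_prod x a a)%E ->
  exists2 xi, remainder xi & visual_close d xi a.
have loc a : [set: C] a -> \forall a' \near a & t \near +oo, P t a'.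
  move=> _; have [ra|[y ->]] := remainder_or_emb a.
    exists ([set a' | visual_close d a a'], setT) => /=.
      by split; [exact: near_visual_close | exact: filterT].
    by move=> [a' t] /= [ca' _] _; exists a.
  exists ([set a | (gps_prod x a a < (mdist x y + 1)%:E)%E],
          [set t | mdist x y + 1 < t]) => /=.
    by split; [exact: near_diag_lt | exact: nbhs_pinfty_gt (num_real _)].
  move=> [a' t] /= [lt_a' lt_t] /le_lt_trans/(_ lt_a').
  by rewrite lte_fin ltNge (ltW lt_t).
have [t tP] := filter_ex (cptC R +oo P _ loc).
exists t => y ty; apply: (tP (emb y) I).
by rewrite gps_prod_diag lee_fin.
Qed.

(** On the remainder visual vanishes only on the diagonal, and compactness of C * C
    makes this quantitative.  Pairs with a coordinate inside X have a neighbourhood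
    without pairs of boundary points. *)
Lemma small_visual_close (d : R) : 0 < d -> exists2 e, 0 < e &
  forall xi eta : C, remainder xi -> remainder eta -> visual xi eta < e ->
  visual_close d xi eta.
Proof.
move=> d0; have cptC := @cpt_compact _ C.
have := compact_setX cptC cptC; rewrite setXTT => /compact_near_coveringP cptCC.
pose P (e : R) (p : C * C) := remainder p.1 -> remainder p.2 ->
  visual p.1 p.2 < e -> visual_close d p.1 p.2.
have far_rem (a : C) y : (gps_prod x a a < (mdist x y + 1)%:E)%E -> ~ remainder a.
  by move=> lta /gps_prod_diag_remainder aoo; move: lta; rewrite aoo.
have loc p : [set: C * C] p -> \forall q \near p & e \near 0^'+, P e q.
  move: p => [a a'] _; have [ra|[y ->]] := remainder_or_emb a; last first.
    exists ([set q | (gps_prod x q.1 q.1 < (mdist x y + 1)%:E)%E], setT) => /=.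
      split; last exact: filterT.
      exact: (cvg_fst (near_diag_lt y)).
    by move=> [q e] /= [/far_rem].
  have [ra'|[y ->]] := remainder_or_emb a'; last first.
    exists ([set q | (gps_prod x q.2 q.2 < (mdist x y + 1)%:E)%E], setT) => /=.
      split; last exact: filterT.
      exact: (cvg_snd (near_diag_lt y)).
    by move=> [q e] /= [/far_rem + _] _.
  have [<-|aa'] := pselect (a = a').
    have d2 : 0 < d / 2 by rewrite divr_gt0.
    have na := near_visual_close a d2.
    exists ([set q | visual_close (d / 2) a q.1 /\ visual_close (d / 2) a q.2],
      setT) => /=.
      split; last exact: filterT.
      by apply: filterI; [exact: (cvg_fst na) | exact: (cvg_snd na)].
    move=> [q e] /= [[c1 c2] _] _ _ _; rewrite [d]splitr.
    exact: visual_close_trans (visual_close_sym c1) c2.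
  have v0 : 0 < visual a a'.
    by apply: visual_gt0; apply/eqP => /(gps_prod_pinfty x ra ra').
  have v2 : 0 < visual a a' / 2 by rewrite divr_gt0.
  exists ([set q | `|visual a a' - visual q.1 q.2| < visual a a' / 2],
    [set e | e < visual a a' / 2]) => /=.
    split; last exact: nbhs_right_lt.
    by have /cvgrPdist_lt/(_ _ v2) := @continuous_visual (a, a').
  by move=> [q e] /= [+ eV] _ _ qe; rewrite ltr_norml; lra.
have : \forall e \near 0^'+, 0 < e /\ forall q, P e q.
  apply: filterI; first exact: nbhs_right_gt.
  by apply: filterS (cptCC R 0^'+ P _ loc) => e eP q; exact: eP.
by move=> /filter_ex [e [e0 eP]]; exists e => // xi eta; exact: (eP (xi, eta)).
Qed.

End boundary.

(** * From an almost-isometry of boundaries to a correspondence of far points *)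

(** The exponential recovers products below r with Lipschitz constant e^r. *)
Lemma min_expR_lip (a b r : R) :
  `|Num.min a r - Num.min b r| <= expR r * `|expR (- a) - expR (- b)|.
Proof.
wlog ab : a b / a <= b => [H|].
  have [/H//|/ltW/H] := leP a b.
  by rewrite distrC [X in _ * X]distrC.
have ab' : expR (- b) <= expR (- a) by rewrite ler_expR lerN2.
rewrite [`|expR _ - _|]ger0_norm ?subr_ge0//.
have [ra|ar] := leP r a.
  have rb : r <= b := le_trans ra ab.
  rewrite !min_r// subrr normr0 mulr_ge0 ?expR_ge0 ?subr_ge0//.
set m := Num.min b r.
have [mb mr] : m <= b /\ m <= r by rewrite !ge_min !lexx orbT.
have am : a <= m by rewrite le_min ab ltW.
rewrite distrC ger0_norm ?subr_ge0//.
have e1 : m - a <= expR (m - a) - 1.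
  by have := expR_ge1Dx (m - a); lra.
apply: (le_trans e1).
have -> : expR (m - a) - 1 = expR m * (expR (- a) - expR (- m)).
  by rewrite mulrBr -!expRD subrr expR0.
apply: ler_pM; rewrite ?expR_ge0 ?ler_expR// ?subr_ge0 ?ler_expR ?lerN2//.
by rewrite lerD2l lerN2 ler_expR lerN2.
Qed.

Lemma AI_isometry_dist (Z1 Z2 : Type) (rho1 : Z1 -> Z1 -> R)
    (rho2 : Z2 -> Z2 -> R) (e : R) (f : Z1 -> Z2) (u v : Z1) :
  AI_isometry rho1 rho2 e f -> `|rho2 (f u) (f v) - rho1 u v| < e.
Proof.
move=> [+ _]; rewrite -lte_fin; apply: le_lt_trans.
by apply: ereal_sup_ubound; exists (u, v).
Qed.

(** u and v are matched when some boundary point xi is close to u and its image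
    f xi is close to v.  Passing from (u,u') to (xi,xi') costs 2 d, from there to
    the images under f costs e <= d, and from the images to (v,v') costs 4 d. *)
Lemma far_correspondence (X Y : metricType R) (GX : gromov_product_space X)
    (GY : gromov_product_space Y) (x : X) (y : Y) (d e t : R)
    (f : gp_boundary GX -> gp_boundary GY) :
  0 < d -> e <= d ->
  (forall xi eta : gps_cpt GY, remainder xi -> remainder eta ->
     visual y xi eta < e -> visual_close y d xi eta) ->
  AI_isometry (rho x) (rho y) e f ->
  (forall v, t <= mdist y v ->
     exists2 eta : gps_cpt GY, remainder eta & visual_close y d eta (cpt_emb _ v)) ->
  exists s C, correspondence [set u | s <= mdist x u] [set v | t <= mdist y v] C /\
    forall u v u' v', C u v -> C u' v' ->
      `|expR (- gromov_product x u u') - expR (- gromov_product y v v')| <= 7 * d.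
Proof.
move=> d0 ed small AIf farY.
have [s farX] := far_approx GX x d0.
pose C u v := exists2 xi : gp_boundary GX,
  visual_close x d (set_val xi) (cpt_emb (gps_cpt GX) u) &
  visual_close y (2 * d) (set_val (f xi)) (cpt_emb (gps_cpt GY) v).
exists s, C; split; first split=> [u /farX [xi rxi cu] | v /farY [eta reta cv]].
- pose xi' : gp_boundary GX := SigSub (mem_set rxi).
  have [v tv cv] := remainder_approx y t (set_valP (f xi')) d0.
  exists v => //; exists xi' => // b.
  by have := cv b; rewrite !ler_norml; lra.
- pose eta' : gp_boundary GY := SigSub (mem_set reta).
  have [xi fxi] := AIf.2 eta'.
  have [u su cu] := remainder_approx x s (set_valP xi) d0.
  exists u => //; exists xi => //.
  have -> : 2 * d = d + d by lra.
  by apply: visual_close_trans cv; apply: small => //; exact: set_valP.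
- move=> u v u' v' [xi cu cv] [xi' cu' cv'].
  rewrite -(visual_emb GX) -(visual_emb GY).
  have := visual_close_both cu cu'; have := visual_close_both cv cv'.
  have := AI_isometry_dist xi xi' AIf.
  rewrite /rho -/(visual y _ _) -/(visual x _ _) !ler_norml ltr_norml; lra.
Qed.

End visual.

Theorem corollary1p2 (R : realType)
    (X_ : nat -> metricType R) (G_ : forall n, gromov_product_space (X_ n))
    (x_ : forall n, X_ n)
    (X : metricType R) (G : gromov_product_space X) (x : X) :
  AI_converges (fun n => rho (G := G_ n) (x_ n)) (rho (G := G) x) ->
  pGH_converges (fun n => hull_emb (x_ n)) (hull_emb x).
Proof.
move=> AI r e r0 e0.
have er0 := expR_gt0 r.
(* D is the distortion fed to hull_GH_isometry, which needs 18 D < e; d yields D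
   after the losses 7 of far_correspondence and e^r of min_expR_lip. *)
pose D := e / 20.
pose d := D / (7 * expR r).
have D0 : 0 < D by rewrite divr_gt0.
have d0 : 0 < d by rewrite divr_gt0// mulr_gt0.
have [e1 e10 small] := small_visual_close G x d0.
have [t farX] := far_approx G x d0.
pose e2 := Num.min e1 d.
have e20 : (0 < e2%:E)%E by rewrite lte_fin lt_min e10.
have : \forall n \near \oo,
    (d_AI (rho (G := G_ n) (x_ n)) (rho (G := G) x) < e2%:E)%E.
  exact: (AI _ (open_ereal_lt' e20)).
move=> [n0 _ n0P]; exists n0 => n /n0P /= /ereal_inf_lt[_ [e3 [_ [f AIf] _] <-]].
rewrite lte_fin lt_min => /andP[/ltW e31 /ltW e3d].
have [|s [C [cor dis]]] := far_correspondence d0 e3d _ AIf farX.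
  by move=> xi eta rxi reta v; apply: small => //; exact: lt_le_trans v e31.
apply: (hull_GH_isometry (ltW r0) D0 _ _ _ cor).
- by rewrite /D; lra.
- exact: far_detecting (gps_geodesic (G_ n)) (gps_complete (G_ n)).
- exact: far_detecting (gps_geodesic G) (gps_complete G).
- move=> u v u' v' _ _ Cuv _ _ Cuv'.
  apply: (le_trans (min_expR_lip _ _ _)).
  have -> : D = expR r * (7 * d) by rewrite /d; field; rewrite gt_eqF.
  by rewrite ler_pM2l// dis.
Qed.
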